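(* Let $A\in\mathbb{R}^{m\times n}$ and let $\mathbf{b}=[\underline b,\overline b]\subseteq\mathbb{R}^m$, $\mathbf{c}=[\underline c,\overline c]\subseteq\mathbb{R}^n$ be interval vectors. The type (A) interval linear program with degenerated matrix $\min\{\mathbf{c}^{\top}x : Ax=\mathbf{b},\ x\ge 0\}$ has strongly zero duality gap if and only if at least one of the following conditions holds: (i) for each $p\in\{\pm1\}^m$ the linear system $Ax=b_c+\mathrm{diag}(p)\,b_\Delta,\ x\ge 0$ is feasible; (ii) the linear system $A^{\top}y\le\underline{c}$ is feasible.
   Context: For $\underline b\le\overline b$ (entrywise), $\mathbf{b}=[\underline b,\overline b]=\{b:\underline b\le b\le\overline b\}$, and similarly for $\mathbf{c}$. $b_c=\frac12(\underline b+\overline b)$, $b_\Delta=\frac12(\overline b-\underline b)$, and $\mathrm{diag}(p)$ is the diagonal matrix with diagonal entries the entries of $p$. The interval linear program is the family of linear programs $\min\{c^{\top}x: Ax=b,\ x\ge 0\}$ over all scenarios $(A,b,c)$ with $b\in\mathbf{b}$, $c\in\mathbf{c}$ and the fixed real matrix $A$ (''degenerated matrix''). The dual of the scenario $(A,b,c)$ is $\max\{b^{\top}y: A^{\top}y\le c\}$. A scenario has zero duality gap if and only if at least one of its primal and dual linear programs is feasible (otherwise the duality gap is $\infty$). The duality gap of the interval linear program is strongly zero if all scenarios have zero duality gap. *)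

(* Defs.v *)
From HB Require Import structures.
From mathcomp Require Import all_boot all_order all_algebra.
From mathcomp Require Import all_classical all_reals ereal.

Set Implicit Arguments.
Unset Strict Implicit.
Unset Printing Implicit Defensive.

Import Order.TTheory GRing.Theory Num.Theory.
Local Open Scope classical_set_scope.
Local Open Scope ring_scope.

Section IntervalLP.
Context {R : realType}.

Definition cv_le (k : nat) (u v : 'cV[R]_k) : Prop :=
  forall i, u i ord0 <= v i ord0.

Definition interval_vector (k : nat) (lo hi : 'cV[R]_k) : set 'cV[R]_k :=
  [set v | cv_le lo v /\ cv_le v hi].

Definition center (k : nat) (lo hi : 'cV[R]_k) : 'cV[R]_k :=
  2^-1 *: (lo + hi).

Definition radius (k : nat) (lo hi : 'cV[R]_k) : 'cV[R]_k :=
  2^-1 *: (hi - lo).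

Definition sign_vector (k : nat) (p : 'cV[R]_k) : Prop :=
  forall i, p i ord0 = 1 \/ p i ord0 = -1.

Definition dotv (k : nat) (u v : 'cV[R]_k) : R := (u^T *m v) ord0 ord0.

Section Scenario.
Variables (m n : nat) (A : 'M[R]_(m, n)) (b : 'cV[R]_m) (c : 'cV[R]_n).

Definition primal_feasible_set : set 'cV[R]_n :=
  [set x | A *m x = b /\ cv_le 0 x].

Definition dual_feasible_set : set 'cV[R]_m :=
  [set y | cv_le (A^T *m y) c].

(* The infimum is +oo for an infeasible program, -oo for an unbounded one. *)
Definition primal_value : \bar R :=
  ereal_inf [set (dotv c x)%:E | x in primal_feasible_set].

(* The supremum is -oo for an infeasible program, +oo for an unbounded one. *)
Definition dual_value : \bar R :=
  ereal_sup [set (dotv b y)%:E | y in dual_feasible_set].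

(* An equality rather than a vanishing difference, because the gap is zero when
   both values are the same infinity, whereas +oo - +oo is -oo in \bar R. *)
Definition zero_duality_gap : Prop := primal_value = dual_value.

End Scenario.

Definition strongly_zero_duality_gap (m n : nat) (A : 'M[R]_(m, n))
    (bb : set 'cV[R]_m) (cc : set 'cV[R]_n) : Prop :=
  forall b c, bb b -> cc c -> zero_duality_gap A b c.

End IntervalLP.

(* Main.v *)
Require Import Defs.
From HB Require Import structures.
From mathcomp Require Import all_boot all_order all_algebra.
From mathcomp Require Import all_classical all_reals ereal.
From mathcomp Require Import lra.

Set Implicit Arguments.
Unset Strict Implicit.
Unset Printing Implicit Defensive.

Import Order.TTheory GRing.Theory Num.Theory.
Local Open Scope classical_set_scope.
Local Open Scope ring_scope.

(** Everything rests on linear programming duality for a single scenario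
    ([zero_duality_gapP]): the gap is zero exactly when the primal or the dual
    program is feasible.  Indeed, when both are infeasible the two values are
    [+oo] and [-oo]; when one of them is feasible the values agree by strong
    duality, which comes down to the lemma of Farkas.

    Hence a nonzero gap means that some [b] makes the primal infeasible and some
    [c] makes the dual infeasible.  As [b] and [c] vary independently, the gap
    is strongly zero iff the primal is feasible for every [b] or the dual is
    feasible for every [c].  The dual is most constrained at [c_lo], which gives
    condition (ii).  For the primal, the feasible right-hand sides form a convex
    cone, so they contain the whole box as soon as they contain its vertices,
    which are the vectors [center + diag p * radius] of condition (i)
    ([primal_feasible_vertices]). *)

(** * Scalar product and entrywise order *)

Section DotProduct.
Context {R : realType}.

Lemma dotvE k (u v : 'cV[R]_k) : dotv u v = \sum_i u i ord0 * v i ord0.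
Proof. by rewrite /dotv mxE; apply: eq_bigr => i _; rewrite mxE. Qed.

Lemma dotvC k (u v : 'cV[R]_k) : dotv u v = dotv v u.
Proof. by rewrite !dotvE; apply: eq_bigr => i _; rewrite mulrC. Qed.

Lemma dotvDr k (u v w : 'cV[R]_k) : dotv u (v + w) = dotv u v + dotv u w.
Proof. by rewrite /dotv mulmxDr mxE. Qed.

Lemma dotvDl k (u v w : 'cV[R]_k) : dotv (u + v) w = dotv u w + dotv v w.
Proof. by rewrite !(dotvC _ w) dotvDr. Qed.

Lemma dotvZr k a (u v : 'cV[R]_k) : dotv u (a *: v) = a * dotv u v.
Proof. by rewrite /dotv -scalemxAr mxE. Qed.

Lemma dotvZl k a (u v : 'cV[R]_k) : dotv (a *: u) v = a * dotv u v.
Proof. by rewrite dotvC dotvZr dotvC. Qed.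

Lemma dotv_mulmx m n (A : 'M[R]_(m, n)) x y :
  dotv (A *m x) y = dotv x (A^T *m y).
Proof. by rewrite /dotv trmx_mul mulmxA. Qed.

Lemma dotv_col_mx k l (u1 v1 : 'cV[R]_k) (u2 v2 : 'cV[R]_l) :
  dotv (col_mx u1 u2) (col_mx v1 v2) = dotv u1 v1 + dotv u2 v2.
Proof. by rewrite /dotv tr_col_mx mul_row_col mxE. Qed.

Lemma dotv_scalar (a b : R) : dotv a%:M b%:M = a * b.
Proof. by rewrite dotvE big_ord1 !mxE eqxx. Qed.

Lemma cv_ge0Z k a (v : 'cV[R]_k) : 0 <= a -> cv_le 0 v -> cv_le 0 (a *: v).
Proof. by move=> a0 v0 i; have := v0 i; rewrite !mxE; apply: mulr_ge0. Qed.

Lemma cv_ge0D k (u v : 'cV[R]_k) :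
  cv_le 0 u -> cv_le 0 v -> cv_le 0 (u + v).
Proof.
move=> u0 v0 i; have := v0 i; have := u0 i; rewrite !mxE.
exact: addr_ge0.
Qed.

Lemma ler_dotv2l k (x u v : 'cV[R]_k) :
  cv_le 0 x -> cv_le u v -> dotv x u <= dotv x v.
Proof.
move=> x0 uv; rewrite !dotvE; apply: ler_sum => i _.
by apply: ler_wpM2l (uv i); have := x0 i; rewrite mxE.
Qed.

Lemma dotv_ge0 k (u v : 'cV[R]_k) : cv_le 0 u -> cv_le 0 v -> 0 <= dotv u v.
Proof.
move=> u0 v0; apply: le_trans (ler_dotv2l u0 v0).
by rewrite /dotv mulmx0 mxE.
Qed.

Lemma cv_le_col_mx k l (u1 v1 : 'cV[R]_k) (u2 v2 : 'cV[R]_l) :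
  cv_le (col_mx u1 u2) (col_mx v1 v2) <-> cv_le u1 v1 /\ cv_le u2 v2.
Proof.
split=> [h|[h1 h2] i].
  split=> i; first by have := h (lshift _ i); rewrite !col_mxEu.
  by have := h (rshift _ i); rewrite !col_mxEd.
by rewrite !mxE; case: splitP => j _.
Qed.

Lemma cv_le0_col_mx k l (u : 'cV[R]_k) (v : 'cV[R]_l) :
  cv_le 0 (col_mx u v) <-> cv_le 0 u /\ cv_le 0 v.
Proof. by rewrite -cv_le_col_mx col_mx0. Qed.

Lemma cv_le_scalar (a b : R) : cv_le a%:M b%:M <-> a <= b.
Proof.
split=> [/(_ ord0)|ab i]; first by rewrite !mxE eqxx.
by rewrite (ord1 i) !mxE eqxx.
Qed.

Lemma cv_le0_scalar (a : R) : cv_le 0 a%:M <-> 0 <= a.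
Proof. by rewrite -cv_le_scalar raddf0. Qed.

End DotProduct.

(** * The lemma of Farkas *)

Section Farkas.
Context {R : realType}.

(** Bartl's algebraic proof, by induction on the columns of [A].  If the first
    column [a] can be omitted from the premise, the induction hypothesis
    applies.  Otherwise some [y0] violates the conclusion while meeting all
    constraints but that of [a], and may be scaled so that [a . y0 = -1].
    Moving any [y] along [y0] until its product with [a] vanishes gives a
    problem with one column fewer; its solution solves the original problem
    once the coefficient [mu] of [a] collects the correction terms. *)
Lemma farkas m n (A : 'M[R]_(m, n)) (b : 'cV[R]_m) :
  (forall y, cv_le 0 (A^T *m y) -> 0 <= dotv b y) ->
  primal_feasible_set A b !=set0.
Proof.
elim: n A b => [|n IHn] A b Ab.
  (* Without columns every vector meets the premise, in particular [- b]. *)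
  have bN : 0 <= dotv b (- b) by apply: Ab => -[].
  exists 0; split; last by case.
  rewrite mulmx0; apply/esym/matrixP => i j; rewrite (ord1 j) mxE.
  have bb : \sum_i b i ord0 ^+ 2 = 0.
    apply/eqP; rewrite eq_le sumr_ge0 ?andbT; last by move=> *; exact: sqr_ge0.
    rewrite -oppr_ge0 (le_trans bN)// dotvE -sumrN ler_sum// => k _.
    by rewrite mxE mulrN.
  move/eqP: bb; rewrite psumr_eq0 => [/allP|k _]; last exact: sqr_ge0.
  by move=> /(_ i (mem_index_enum _)) /=; rewrite sqrf_eq0 => /eqP.
have [a [A' defA]] : exists a A', A = row_mx a A' :> 'M_(m, 1 + n).
  by exists (lsubmx (A : 'M_(m, 1 + n))), (rsubmx (A : 'M_(m, 1 + n)));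
     rewrite hsubmxK.
rewrite {}defA in Ab *.
have {}Ab y : cv_le 0 ((row_mx a A')^T *m y) -> 0 <= dotv b y by exact: Ab.
(* Restating the goal gives [A] the width [1 + n] of a block matrix. *)
suff : primal_feasible_set (row_mx a A') b !=set0 by [].
have Ab' y : 0 <= dotv a y -> cv_le 0 (A'^T *m y) -> 0 <= dotv b y.
  move=> ay A'y; apply: Ab; rewrite tr_row_mx mul_col_mx.
  by apply/cv_le0_col_mx; split => // i; rewrite (ord1 i) mxE.
have [A'b|] := pselect (forall y, cv_le 0 (A'^T *m y) -> 0 <= dotv b y).
  have [x [<- x0]] := IHn _ _ A'b.
  exists (col_mx 0 x); split; first by rewrite mul_row_col mulmx0 add0r.
  by apply/cv_le0_col_mx; split=> // i; rewrite !mxE.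
move=> /existsNP[y1 /not_implyP[A'y1 /negP]]; rewrite -ltNge => by1.
have ay1 : dotv a y1 < 0.
  by rewrite ltNge; apply/negP => ay1; move: by1; rewrite ltNge Ab'.
have [y0 [ay0 A'y0 by0]] :
    exists y0, [/\ dotv a y0 = -1, cv_le 0 (A'^T *m y0) & dotv b y0 <= 0].
  have s0 : 0 < - (dotv a y1)^-1 by rewrite oppr_gt0 invr_lt0.
  exists (- (dotv a y1)^-1 *: y1); split.
  - by rewrite dotvZr mulNr mulVf// lt_eqF.
  - by rewrite -scalemxAr; apply: cv_ge0Z (ltW s0) A'y1.
  - by rewrite dotvZr pmulr_rle0// ltW.
(* [B^T y = A'^T z] for the projection [z = y + (a . y) y0] of [y] onto the
   hyperplane orthogonal to [a]. *)
pose B := A' + a *m (A'^T *m y0)^T.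
have [y|x [Bx x0]] := IHn B (b + dotv b y0 *: a).
  pose z := y + dotv a y *: y0.
  have -> : B^T *m y = A'^T *m z.
    rewrite /B linearD/= trmx_mul trmxK mulmxDl mulmxDr -!mulmxA.
    congr (_ + _ *m _).
    have -> : a^T *m y = (dotv a y)%:M by rewrite [LHS]mx11_scalar.
    by rewrite mul_mx_scalar.
  have -> : dotv (b + dotv b y0 *: a) y = dotv b z.
    by rewrite dotvDl dotvZl dotvDr dotvZr mulrC.
  by apply: Ab'; rewrite dotvDr dotvZr ay0 mulrN1 subrr.
pose mu := dotv x (A'^T *m y0) - dotv b y0.
exists (col_mx mu%:M x); split.
  rewrite mul_row_col mul_mx_scalar /mu scalerBl addrAC.
  apply/eqP; rewrite subr_eq -Bx /B mulmxDl addrC -mulmxA.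
  have -> : (A'^T *m y0)^T *m x = (dotv x (A'^T *m y0))%:M.
    by rewrite dotvC [LHS]mx11_scalar.
  by rewrite mul_mx_scalar.
apply/cv_le0_col_mx; split=> //; apply/cv_le0_scalar.
by rewrite subr_ge0 (le_trans by0)// dotv_ge0.
Qed.

(** The affine version follows by homogenization: in the unknowns [(- z, t)], the
    system [M z <= t d], [t >= 0] has no solution with [t > 0], since dividing by
    [t] would solve [M z <= d].  So it implies [- t >= 0], and the homogeneous
    version writes this inequality as a combination of those of the system. *)
Lemma farkas_le k r (M : 'M[R]_(r, k)) (d : 'cV[R]_r) :
  ~ (exists z, cv_le (M *m z) d) ->
  exists u, [/\ cv_le 0 u, M^T *m u = 0 & dotv d u < 0].
Proof.
move=> Md; pose N : 'M[R]_(k + 1, r + 1) := block_mx M^T 0 d^T 1%:M.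
have [w|u [Nu u0]] := @farkas _ _ N (col_mx 0 (- 1)%:M).
  rewrite -[w]vsubmxK; set z := usubmx w; rewrite [dsubmx w]mx11_scalar.
  set t := dsubmx w ord0 ord0.
  rewrite /N tr_block_mx mul_block_col !trmxK trmx0 mul0mx add0r trmx1 mul1mx.
  move=> /cv_le0_col_mx[Mz /cv_le0_scalar t0].
  rewrite dotv_col_mx dotv_scalar mulN1r /dotv trmx0 mul0mx mxE add0r oppr_ge0.
  rewrite leNgt; apply/negP => t_gt0; apply: Md.
  exists (- t^-1 *: z) => i; have := Mz i.
  rewrite -scalemxAr mul_mx_scalar !mxE mulNr mulrC => h.
  by rewrite lerNl [leRHS]mulrC ler_pdivlMr// mulNr -subr_ge0 opprK.
move: Nu u0; rewrite -[u]vsubmxK; set x := usubmx u.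
rewrite [dsubmx u]mx11_scalar; set s := dsubmx u ord0 ord0.
rewrite mul_block_col mul0mx addr0 mul1mx => /eq_col_mx[Mx dx].
move=> /cv_le0_col_mx[x0 /cv_le0_scalar s0]; exists x; split=> //.
move/matrixP: dx => /(_ ord0 ord0); rewrite mxE -/(dotv d x) !mxE !eqxx /=.
lra.
Qed.

End Farkas.

(** * Linear programming duality for one scenario *)

Section Duality.
Context {R : realType}.
Variables (m n : nat) (A : 'M[R]_(m, n)) (b : 'cV[R]_m) (c : 'cV[R]_n).

Lemma weak_duality x y : primal_feasible_set A b x -> dual_feasible_set A c y ->
  dotv b y <= dotv c x.
Proof.
by move=> [<- x0] yc; rewrite dotv_mulmx (dotvC c) ler_dotv2l.
Qed.

(** A recession direction of negative cost makes a feasible program unbounded. *)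
Lemma primal_ray_lt x0 x t : primal_feasible_set A b x0 ->
    A *m x = 0 -> cv_le 0 x -> dotv c x < 0 ->
  exists2 x', primal_feasible_set A b x' & dotv c x' < t.
Proof.
move=> [Ax0 x0_ge0] Ax x_ge0 cx.
(* The second argument of the maximum exceeds by 1 the step at which the
   objective value reaches [t]. *)
pose l := Num.max 0 (1 + (t - dotv c x0) / dotv c x).
have l0 : 0 <= l by rewrite le_max lexx.
exists (x0 + l *: x).
  split; first by rewrite mulmxDr -scalemxAr Ax scaler0 addr0.
  by apply: cv_ge0D x0_ge0 _; apply: cv_ge0Z.
rewrite dotvDr dotvZr -ltrBrDl -ltr_ndivrMr//.
by rewrite lt_max ltrDr ltr01 orbT.
Qed.

(** This is strong duality tested at a real level [t].  If no dual solution
    reaches [t], Farkas applied to [A^T y <= c], [b . y >= t] gives [x >= 0] and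
    [s >= 0] with [A x = s b] and [c . x < s t].  When [s > 0], [x / s] is a
    primal solution below [t].  When [s = 0], [x] is a recession direction of
    negative cost: it rules out dual solutions, so there is a primal one, from
    which it leads below [t].

    Excluding the case where both programs are infeasible is necessary: a
    direction with [s = 0] then exists, with no point to start from. *)
Lemma lp_alternative t :
  primal_feasible_set A b !=set0 \/ dual_feasible_set A c !=set0 ->
  (exists2 y, dual_feasible_set A c y & t <= dotv b y) \/
  (exists2 x, primal_feasible_set A b x & dotv c x < t).
Proof.
move=> feas.
have [|/farkas_le] := pselect (exists y,
  cv_le (col_mx A^T (- b^T) *m y) (col_mx c (- t)%:M)).
  move=> [y]; rewrite mul_col_mx => /cv_le_col_mx[yc bt]; left; exists y => //.
  by have := bt ord0; rewrite mulNmx [leLHS]mxE -/(dotv b y) [leRHS]mxE eqxx lerN2.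
move=> [u]; rewrite -[u]vsubmxK; set x := usubmx u.
rewrite [dsubmx u]mx11_scalar; set s := dsubmx u ord0 ord0.
rewrite tr_col_mx trmxK linearN/= trmxK mul_row_col mulNmx mul_mx_scalar.
rewrite dotv_col_mx dotv_scalar.
move=> [/cv_le0_col_mx[x0 /cv_le0_scalar s0] /eqP].
rewrite subr_eq0 => /eqP Ax cx; right.
have [s_eq0|s_neq0] := eqVneq s 0.
  move: Ax cx; rewrite s_eq0 scale0r mulr0 addr0 => Ax cx.
  case: feas => [[x1 Px1]|[y yc]]; first exact: primal_ray_lt Px1 Ax x0 cx.
  have := ler_dotv2l x0 yc; rewrite -dotv_mulmx Ax dotvC /dotv mulmx0 mxE.
  by rewrite -/(dotv x c) dotvC leNgt cx.
have s_gt0 : 0 < s by rewrite lt_def s_neq0.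
exists (s^-1 *: x).
  split; first by rewrite -scalemxAr Ax scalerA mulVf// scale1r.
  by apply: cv_ge0Z x0; rewrite invr_ge0.
by rewrite dotvZr mulrC ltr_pdivrMr// -subr_lt0 -mulNr.
Qed.

Lemma strong_duality :
  primal_feasible_set A b !=set0 \/ dual_feasible_set A c !=set0 ->
  zero_duality_gap A b c.
Proof.
move=> feas; apply/eqP; rewrite eq_le; apply/andP; split; last first.
  apply: ge_ereal_sup => _ [y yc <-]; apply: le_ereal_inf_tmp => _ [x xb <-].
  by rewrite lee_fin weak_duality.
have key t : (dual_value A b c < t%:E -> primal_value A b c <= t%:E)%E.
  move=> dt; case: (lp_alternative t feas) => [[y yc ty]|[x xb xt]].
    move: dt; rewrite ltNge => /negP[].
    by apply: le_ereal_sup_tmp; exists (dotv b y)%:E => //; exists y.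
  apply: ge_ereal_inf; exists (dotv c x)%:E; first by exists x.
  by rewrite lee_fin ltW.
case: (dual_value A b c) key => [r| |] key.
- by apply/lee_addgt0Pr => e e0; apply: key; rewrite lte_fin ltrDl.
- exact: leey.
- by rewrite leeNy_eq; apply/eqP/eq_ninfty => t; apply: key; rewrite ltNyr.
Qed.

Lemma zero_duality_gapP : zero_duality_gap A b c <->
  primal_feasible_set A b !=set0 \/ dual_feasible_set A c !=set0.
Proof.
split=> [gap|]; last exact: strong_duality.
apply: contrapT => /not_orP[/nonemptyPn P0 /nonemptyPn D0].
move: gap; rewrite /zero_duality_gap /primal_value /dual_value P0 D0.
by rewrite !image_set0 ereal_inf0 ereal_sup0.
Qed.

End Duality.

(** * Right-hand sides in a box *)

Section Interval.
Context {R : realType}.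

Definition vertex k (lo hi p : 'cV[R]_k) : 'cV[R]_k :=
  center lo hi + diag_mx p^T *m radius lo hi.

Lemma vertexE k (lo hi p : 'cV[R]_k) i : sign_vector p ->
  vertex lo hi p i ord0 = if 0 < p i ord0 then hi i ord0 else lo i ord0.
Proof.
move=> /(_ i) p1; rewrite /vertex mul_diag_mx !mxE.
by case: p1 => ->; rewrite ?ltr01 ?ltr0N1; lra.
Qed.

Lemma vertex_in k (lo hi p : 'cV[R]_k) : cv_le lo hi -> sign_vector p ->
  interval_vector lo hi (vertex lo hi p).
Proof.
by move=> lohi sp; split=> i; rewrite vertexE//; case: ifP => // _;
  apply: lohi.
Qed.

(** By Farkas it suffices that [b . y >= 0] whenever [A^T y >= 0].  Over the box,
    the product with [y] is minimal at the vertex that takes the lower bound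
    where [y] is nonnegative and the upper bound elsewhere, and there it is
    nonnegative because this vertex is [A x] with [x >= 0]. *)
Lemma primal_feasible_vertices m n (A : 'M[R]_(m, n)) (lo hi b : 'cV[R]_m) :
  (forall p, sign_vector p ->
     primal_feasible_set A (vertex lo hi p) !=set0) ->
  interval_vector lo hi b -> primal_feasible_set A b !=set0.
Proof.
move=> feas [lob bhi]; apply: farkas => y Ay.
pose p : 'cV[R]_m := \col_i (if 0 <= y i ord0 then -1 else 1).
have sp : sign_vector p by move=> i; rewrite mxE; case: ifP; [right|left].
have [x [Ax x0]] := feas p sp.
have : 0 <= dotv (vertex lo hi p) y by rewrite -Ax dotv_mulmx dotv_ge0.
move=> /le_trans; apply; rewrite !dotvE; apply: ler_sum => i _.
rewrite vertexE// mxE; case: (lerP 0 (y i ord0)) => yi.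
  by rewrite ltr0N1 ler_wpM2r.
by rewrite ltr01 ler_wnM2r// ltW.
Qed.

End Interval.

Theorem corollary9 (R : realType) (m n : nat) (A : 'M[R]_(m, n))
    (b_lo b_hi : 'cV[R]_m) (c_lo c_hi : 'cV[R]_n)
    (hb : cv_le b_lo b_hi) (hc : cv_le c_lo c_hi) :
  strongly_zero_duality_gap A
    (interval_vector b_lo b_hi) (interval_vector c_lo c_hi) <->
  (forall p : 'cV[R]_m, sign_vector p ->
     exists x : 'cV[R]_n,
       A *m x = center b_lo b_hi + diag_mx p^T *m radius b_lo b_hi /\
       cv_le 0 x) \/
  (exists y : 'cV[R]_m, cv_le (A^T *m y) c_lo).
Proof.
split=> [gap|feas b c bb [c_ge _]].
  apply: contrapT => /not_orP[/existsNP[p /not_implyP[sp Pp]] Dc].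
  have cc : interval_vector c_lo c_hi c_lo by split=> // i; exact: lexx.
  by have /zero_duality_gapP[] := gap _ _ (vertex_in hb sp) cc.
apply/zero_duality_gapP; case: feas => [Pb|[y yc]].
  by left; apply: primal_feasible_vertices bb.
by right; exists y => i; exact: le_trans (yc i) (c_ge i).
Qed.
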